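(* Let $M_1=\langle (1,2)\rangle\le W_1$, $M_2=\langle (1,3,2,4)\rangle\le W_2$, and for $n\ge3$ let $M_n=\langle x_n,v_{n-3},\dots,v_0\rangle\le W_n$. Then for every $n\ge1$ the group $M_n$ satisfies Model 1, i.e. for every partition $\lambda$ of $2^n$ the proportion of elements of $M_n$ with cycle type $\lambda$ equals the density of $\lambda$ in the level $n$ cycle data of Model 1.
   Context: $W_n$ is the automorphism group of the complete binary rooted tree of height $n$, regarded as a permutation group on its $2^n$ leaves labelled $1,\dots,2^n$ from left to right. Permutations are composed right to left. For $i\le n$, $W_i$ is regarded as a subgroup of $W_n$ acting on the leaves $1,\dots,2^i$ and fixing all others. Put $a_i=\prod_{j=1}^{2^{i-1}}(j,\,j+2^{i-1})$, $x_n=a_1a_2\cdots a_n\in W_n$, and $v_i=x_{i+2}^2$ for $i\ge0$. Model 1. Types are $n$ and $s$. Level $n$ data is a finite collection of pairs (formal commutative product $\prod_i[t_i,d_i]$ with $t_i$ types and $\sum d_i=2^n$; density). The level 1 data is $([n,2],\tfrac12),\ ([n,1][n,1],\tfrac14),\ ([s,1][s,1],\tfrac14)$. Level $n+1$ data is obtained from level $n$ data by replacing, independently, each factor according to: $[n,d]\to[n,2d]$; $[s,d]\to[n,d][n,d]$ or $[s,d][s,d]$, the two alternatives being equally likely; densities multiply accordingly. The level $n$ cycle data assigns to each partition $\lambda$ of $2^n$ the sum of the densities of the products whose multiset of $d_i$ is $\lambda$. *)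

(* Defs.v *)
From HB Require Import structures.
From mathcomp Require Import all_boot all_order all_algebra all_fingroup.
From mathcomp Require Import zify.

Set Implicit Arguments.
Unset Strict Implicit.
Unset Printing Implicit Defensive.

(* The leaf labelled [k], 1 <= k <= 2 ^ n, is the ordinal of value [k - 1];
   labels outside that range are never used. *)
Definition leaf (n k : nat) : 'I_(2 ^ n) :=
  insubd (Ordinal (expn_gt0 2 n : 0 < 2 ^ n)) k.-1.

(* The vertex of height [k] above a leaf of value [i] is the block of leaves
   with the same quotient [i %/ 2 ^ k].  A permutation of the leaves comes from
   an automorphism of the rooted tree iff it is compatible with these blocks. *)
Definition W_set (n : nat) : {set {perm 'I_(2 ^ n)}} :=
  [set s : {perm _} | [forall k : 'I_n.+1, forall i : 'I_(2 ^ n), forall j : 'I_(2 ^ n),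
     (i %/ 2 ^ k == j %/ 2 ^ k) ==> (s i %/ 2 ^ k == s j %/ 2 ^ k)]].

Lemma W_setP n (s : {perm 'I_(2 ^ n)}) :
  reflect (forall (k : 'I_n.+1) (i j : 'I_(2 ^ n)), i %/ 2 ^ k = j %/ 2 ^ k ->
             s i %/ 2 ^ k = s j %/ 2 ^ k) (s \in W_set n).
Proof.
rewrite inE; apply: (iffP idP).
  move=> /forallP H k i j /eqP e.
  by apply/eqP; move: (H k) => /forallP/(_ i)/forallP/(_ j)/implyP; apply.
move=> H; apply/forallP=> k; apply/forallP=> i; apply/forallP=> j.
by apply/implyP=> /eqP /H ->.
Qed.

Lemma W_group_set n : group_set (W_set n).
Proof.
apply/group_setP; split; first by apply/W_setP=> k i j; rewrite !perm1.
move=> s t /W_setP Hs /W_setP Ht; apply/W_setP=> k i j /Hs /Ht.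
by rewrite !permM.
Qed.

Canonical W (n : nat) : {group {perm 'I_(2 ^ n)}} := Group (W_group_set n).

(* [perm]'s product is [(s * t) i = t (s i)]; [comp_perm s t] applies [t] first. *)
Definition comp_perm (T : finType) (s t : {perm T}) : {perm T} := (t * s)%g.

Definition cycle_perm (T : finType) (c : seq T) (Uc : uniq c) : {perm T} :=
  perm (can_inj (prev_next Uc)).

(* As an element of W_n, for 1 <= i <= n. *)
Definition a (n i : nat) : {perm 'I_(2 ^ n)} :=
  (\prod_(1 <= j < (2 ^ i.-1).+1) tperm (leaf n j) (leaf n (j + 2 ^ i.-1)))%g.

(* x_m = a_1 a_2 ... a_m as an element of W_n, for m <= n. *)
Definition x (n m : nat) : {perm 'I_(2 ^ n)} :=
  \big[@comp_perm _/1%g]_(1 <= i < m.+1) a n i.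

Definition v (n i : nat) : {perm 'I_(2 ^ n)} := (x n i.+2 ^+ 2)%g.

Lemma uniq_1324 : uniq [:: leaf 2 1; leaf 2 3; leaf 2 2; leaf 2 4].
Proof. by rewrite /= !inE -!val_eqE /leaf !val_insubd. Qed.

(* [M 0] is a dummy value. *)
Definition M (n : nat) : {group {perm 'I_(2 ^ n)}} :=
  match n with
  | 0 => 1%G
  | 1 => <[tperm (leaf 1 1) (leaf 1 2)]>%G
  | 2 => <[cycle_perm uniq_1324]>%G
  | m.+3 => <<x m.+3 m.+3 |: [set v m.+3 i | i : 'I_m.+1]>>%G
  end.

Lemma val_leaf n k : 0 < k <= 2 ^ n -> val (leaf n k) = k.-1.
Proof. by move=> H; rewrite /leaf val_insubd; case: ifP => //; lia. Qed.

Lemma aE n i (y : 'I_(2 ^ n)) : 0 < i <= n ->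
  val (a n i y) = if y < 2 ^ i.-1 then y + 2 ^ i.-1
                  else if y < 2 ^ i then y - 2 ^ i.-1 else y.
Proof.
case: i => [//|i] /= i_le_n; rewrite /a /=.
have h2 : 2 ^ i.+1 = 2 ^ i + 2 ^ i by rewrite expnS mul2n addnn.
have hn : 2 ^ i.+1 <= 2 ^ n by rewrite leq_exp2l.
suff H m : m <= 2 ^ i -> forall z : 'I_(2 ^ n),
    val ((\prod_(1 <= j < m.+1) tperm (leaf n j) (leaf n (j + 2 ^ i)))%g z)
    = if z < m then z + 2 ^ i
      else if 2 ^ i <= z < 2 ^ i + m then z - 2 ^ i else z.
  rewrite H // h2; case: (ltnP y (2 ^ i)) => // hy.
elim: m => [|m IHm] hm z.
  by rewrite big_geq // perm1 ltn0 addn0; case: ifP => //; lia.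
rewrite big_nat_recr //= permM.
have lm : val (leaf n m.+1) = m by rewrite val_leaf //; lia.
have lm' : val (leaf n (m.+1 + 2 ^ i)) = m + 2 ^ i by rewrite val_leaf //; lia.
have := IHm (ltnW hm) z; set w := fun_of_perm _ z => Hw.
case: tpermP => [E|E|/eqP E1 /eqP E2].
- have := congr1 val E; rewrite lm /= => E'; rewrite lm'.
  by move: Hw; rewrite /= E'; do !case: ifP; lia.
- have := congr1 val E; rewrite lm' /= => E'; rewrite lm.
  by move: Hw; rewrite /= E'; do !case: ifP; lia.
- move: E1 E2; rewrite -!val_eqE lm lm' /= => E1 E2.
  by move: Hw E1 E2 => /= ->; do !case: ifP; lia.
Qed.

Lemma a_in_W n i : 0 < i <= n -> a n i \in W n.
Proof.
move=> Hi; apply/W_setP=> k y z E; rewrite !aE //.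
case: i Hi => [//|i] /= i_le_n.
have h2 : 2 ^ i.+1 = 2 ^ i + 2 ^ i by rewrite expnS mul2n addnn.
have k_gt0 : 0 < 2 ^ k by rewrite expn_gt0.
case: (leqP k i) => [ki|ik].
  have [q Eq] : exists q, 2 ^ i = q * 2 ^ k.
    by exists (2 ^ (i - k)); rewrite -expnD subnK.
  have lt c : forall u : nat, (u < c * 2 ^ k) = (u %/ 2 ^ k < c).
    by move=> u; rewrite ltn_divLR.
  rewrite h2 Eq -mulnDl !lt E.
  case: ifP => _; first by rewrite ![_ + q * _]addnC !divnMDl // E.
  case: ifP => _ //; by rewrite !divnBMl E.
have [q Eq] : exists q, 2 ^ k = q * 2 ^ i.+1.
  by exists (2 ^ (k - i.+1)); rewrite -expnD subnK.
have hk : 2 ^ i.+1 <= 2 ^ k by rewrite leq_exp2l.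
have big0 u : u < 2 ^ i.+1 -> u %/ 2 ^ k = 0.
  by move=> hu; rewrite divn_small //; lia.
have act (u : nat) : (if u < 2 ^ i then u + 2 ^ i
    else if u < 2 ^ i.+1 then u - 2 ^ i else u) %/ 2 ^ k = u %/ 2 ^ k.
  case: ifP => h1; first by rewrite !big0 //; lia.
  by case: ifP => h3 //; rewrite !big0 //; lia.
by rewrite !act.
Qed.

Lemma x_in_W n m : m <= n -> x n m \in W n.
Proof.
move=> mn; rewrite /x big_nat_cond.
elim/big_ind: _ => [|s t Hs Ht|i Hi]; first exact: group1.
  exact: groupM.
by apply: a_in_W; lia.
Qed.

Lemma M_subW n : M n \subset W n.
Proof.
case: n => [|[|[|n]]] /=; first exact: sub1G.
- rewrite cycle_subG; have -> : tperm (leaf 1 1) (leaf 1 2) = a 1 1.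
    by rewrite /a big_nat1.
  exact: a_in_W.
- rewrite cycle_subG; apply/W_setP=> k i j.
  have val_next (y : 'I_(2 ^ 2)) :
      val (cycle_perm uniq_1324 y) = nth 0 [:: 2; 3; 1; 0] y.
    rewrite permE /= -!val_eqE /leaf !val_insubd /=.
    by case: y => [[|[|[|[|]]]]] //= _; rewrite val_insubd.
  rewrite /= !val_next.
  case: k => [[|[|[|]]]] //= _;
  by case: i => [[|[|[|[|]]]]] //= _; case: j => [[|[|[|[|]]]]].
- rewrite gen_subG subUset sub1set x_in_W //=.
  by apply/subsetP=> _ /imsetP[i _ ->]; apply/groupX/x_in_W; have := ltn_ord i; lia.
Qed.

Definition is_partition (N : nat) (lam : seq nat) : bool :=
  [&& sorted geq lam, all (ltn 0) lam & sumn lam == N].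

Definition cycle_type (T : finType) (s : {perm T}) : seq nat :=
  sort geq [seq #|C| | C : {set T} in porbits s].

Inductive model_type := type_n | type_s.

Definition factor := (model_type * nat)%type.

(* A formal commutative product is represented by the list of its factors; the
   cycle data depends on that list only up to reordering.  The same product may
   occur several times in a collection, its densities then being added up. *)
Definition model_data := seq (seq factor * rat).

Local Open Scope ring_scope.

Definition level1 : model_data :=
  [:: ([:: (type_n, 2%N)], 1 / 2);
      ([:: (type_n, 1%N); (type_n, 1%N)], 1 / 4);
      ([:: (type_s, 1%N); (type_s, 1%N)], 1 / 4)].

Definition replace_factor (f : factor) : model_data :=
  match f with
  | (type_n, d) => [:: ([:: (type_n, (2 * d)%N)], 1)]
  | (type_s, d) => [:: ([:: (type_n, d); (type_n, d)], 1 / 2);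
                       ([:: (type_s, d); (type_s, d)], 1 / 2)]
  end.

Fixpoint replace_product (fs : seq factor) : model_data :=
  if fs is f :: fs' then
    [seq (p.1 ++ q.1, p.2 * q.2) | p <- replace_factor f,
                                   q <- replace_product fs']
  else [:: ([::], 1)].

Definition next_level (D : model_data) : model_data :=
  [seq (q.1, p.2 * q.2) | p <- D, q <- replace_product p.1].

(* For n >= 1. *)
Definition level (n : nat) : model_data := iter n.-1 next_level level1.

Definition cycle_data (n : nat) (lam : seq nat) : rat :=
  \sum_(p <- level n | perm_eq [seq f.2 | f <- p.1] lam) p.2.

Definition satisfies_model1 (n : nat) (G : {group {perm 'I_(2 ^ n)}}) : Prop :=
  forall lam : seq nat, is_partition (2 ^ n) lam ->
    #|[set s in G | cycle_type s == lam]|%:R / #|G|%:R = cycle_data n lam.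

(* Main.v *)
Require Import Defs.
From HB Require Import structures.
From mathcomp Require Import all_boot all_order all_algebra all_fingroup.
From mathcomp Require Import zify ring.

Set Implicit Arguments.
Unset Strict Implicit.
Unset Printing Implicit Defensive.

Import GRing.Theory Num.Theory.

(** Call an element of [M n] even when it preserves the two halves of the
    leaves and odd when it exchanges them.  An automorphism of the tree of
    height [n.+1] is a pair [(g, h)] of automorphisms of the two subtrees,
    followed or not by the exchange of the halves ([wreath]).  The theorem
    rests on the description ([M_eq_parities]) of [M n.+2] in terms of
    [M n.+1]: its even elements are the pairs [(g, h)] with [g] and [h] of the
    same parity, and its odd elements are the pairs with [g] and [h] of
    opposite parity, followed by the exchange.

    This determines cycle types recursively.
    - The square of an odd element [(g, h)] followed by the exchange acts on
      the two halves as [g * h] and [h * g], which are odd of height one less.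
      By induction every odd element is a single cycle ([cycle_type_odd]).
    - Among the even elements [(g, h)], one half have [g] and [h] odd, hence
      two cycles of equal length; for the other half [g] and [h] are
      independent and uniformly distributed among the even elements of height
      one less, and the cycles of [(g, h)] are those of [g] and of [h].

    On the side of the model, a factor [[n,d]] only doubles, so it stays one
    cycle; and a factor [[s,1]] obeys the same recursion as the even elements:
    with probability 1/2 it becomes a pair of single cycles, otherwise a pair
    of independent copies of itself ([expect_evolve_s]).  Hence the
    descendants of [[s,1]] after [n] steps have the law of the cycle type of a
    uniform even element ([sum_even]), and the three terms of the first level
    regroup as one half of [[n,2]] and one half of the successors of [[s,1]]
    ([expect_level]).  As half of [M n] is odd and half is even, the two
    distributions agree.

    Distributions are compared by integrating test functions [phi] on lists of
    cycle lengths that are invariant under permutation: the law of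
    a concatenation of two independent lists is then an iterated sum. *)

(** * Tree automorphisms as pairs on the two halves *)

Definition side n (k : 'I_(2 ^ n.+1)) : bool := 2 ^ n <= k.

Definition pos n (k : 'I_(2 ^ n.+1)) : 'I_(2 ^ n) :=
  Ordinal (ltn_pmod k (expn_gt0 2 n : 0 < 2 ^ n)).

Lemma child_subproof n (c : bool) (i : 'I_(2 ^ n)) : c * 2 ^ n + i < 2 ^ n.+1.
Proof. by rewrite expnS; have := ltn_ord i; case: c; lia. Qed.

Definition child n c (i : 'I_(2 ^ n)) : 'I_(2 ^ n.+1) :=
  Ordinal (child_subproof c i).

Lemma side_child n c (i : 'I_(2 ^ n)) : side (child c i) = c.
Proof. by rewrite /side /=; have := ltn_ord i; case: c; lia. Qed.

Lemma pos_child n c (i : 'I_(2 ^ n)) : pos (child c i) = i.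
Proof. by apply: val_inj; rewrite /= modnMDl modn_small. Qed.

Lemma child_side_pos n (k : 'I_(2 ^ n.+1)) : child (side k) (pos k) = k.
Proof.
apply: val_inj; rewrite /= /side [RHS](divn_eq k (2 ^ n)); congr (_ * _ + _).
case: leqP => le_k; last by rewrite divn_small.
rewrite -{1}[val k](subnKC le_k) divnDl // divnn expn_gt0 divn_small //.
by have := ltn_ord k; move: (nat_of_ord k) => m; rewrite expnS; lia.
Qed.

Lemma child_inj n c : injective (@child n c).
Proof. exact: can_inj (@pos_child n c). Qed.

(** The portrait at the root: [p] acts on the two halves, which are then
    exchanged if [b] holds. *)
Definition wreath_fun n b (p : {perm 'I_(2 ^ n)} * {perm 'I_(2 ^ n)})
    (k : 'I_(2 ^ n.+1)) : 'I_(2 ^ n.+1) :=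
  child (side k (+) b) ((if side k then p.2 else p.1) (pos k)).

Lemma wreath_fun_inj n b p : injective (@wreath_fun n b p).
Proof.
move=> k l E; have Es := congr1 (@side n) E; have Ep := congr1 (@pos n) E.
move: Es Ep; rewrite !side_child !pos_child => /addIb Es.
rewrite -Es => /perm_inj Ep.
by rewrite -[k]child_side_pos -[l]child_side_pos Es Ep.
Qed.

Definition wreath n b (p : {perm 'I_(2 ^ n)} * {perm 'I_(2 ^ n)}) :=
  perm (@wreath_fun_inj n b p).

Lemma wreathE n b p c (i : 'I_(2 ^ n)) :
  wreath b p (child c i) = child (c (+) b) ((if c then p.2 else p.1) i).
Proof. by rewrite permE /wreath_fun side_child pos_child. Qed.

Lemma perm_child n (s t : {perm 'I_(2 ^ n.+1)}) :
  (forall c i, s (child c i) = t (child c i)) -> s = t.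
Proof. by move=> E; apply/permP=> k; rewrite -[k]child_side_pos; apply: E. Qed.

Lemma wreath_inj n b b' (p q : {perm 'I_(2 ^ n)} * {perm 'I_(2 ^ n)}) :
  wreath b p = wreath b' q -> b = b' /\ p = q.
Proof.
move=> E; have Ec c i : child (c (+) b) ((if c then p.2 else p.1) i)
    = child (c (+) b') ((if c then q.2 else q.1) i).
  by rewrite -!wreathE E.
split.
  have := congr1 (@side n) (Ec false (leaf n 1)).
  by rewrite !side_child.
have Ep c : (if c then p.2 else p.1) = (if c then q.2 else q.1).
  apply/permP=> i; have := congr1 (@pos n) (Ec c i).
  by rewrite !pos_child.
have := Ep false; have := Ep true.
by case: p q {E Ec Ep} => [? ?] [? ?] /= -> ->.
Qed.

Local Open Scope group_scope.

Lemma wreath_mul0 n b (g h g' h' : {perm 'I_(2 ^ n)}) :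
  wreath false (g, h) * wreath b (g', h') = wreath b (g * g', h * h').
Proof. by apply: perm_child => [] [] i; rewrite permM !wreathE /= permM. Qed.

Lemma wreath_mul1 n b (g h g' h' : {perm 'I_(2 ^ n)}) :
  wreath true (g, h) * wreath b (g', h') = wreath (~~ b) (g * h', h * g').
Proof.
by apply: perm_child => [] [] i; rewrite permM !wreathE /= permM ?negbK.
Qed.

Lemma wreath1 n : wreath false (1, 1) = 1 :> {perm 'I_(2 ^ n.+1)}.
Proof. by apply: perm_child => [] [] i; rewrite wreathE !perm1. Qed.

Lemma wreath_exp n (g h : {perm 'I_(2 ^ n)}) k :
  wreath false (g, h) ^+ k = wreath false (g ^+ k, h ^+ k).
Proof.
by elim: k => [|k IH]; rewrite ?expg0 ?wreath1 // !expgS IH wreath_mul0.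
Qed.

(** * The two parity classes *)

(** [parity n b] is the set of the even ([b = false]) or odd ([b = true])
    elements of [M n], described by recursion on the tree.  At height 0 both
    classes are [[set 1]], which is what makes the recursion yield the two
    elements of [M 1] at height 1; from then on the classes are disjoint. *)
Fixpoint parity n b : {set {perm 'I_(2 ^ n)}} :=
  if n is n'.+1 then
    @wreath n' b @: (setX (parity n' false) (parity n' b)
                     :|: setX (parity n' true) (parity n' (~~ b)))
  else [set 1].

Lemma mem_parity n b s :
  s \in parity n.+1 b <->
  exists g h c,
    [/\ g \in parity n c, h \in parity n (c (+) b) & s = wreath b (g, h)].
Proof.
split=> [/imsetP[[g h]]|[g [h [c [Dg Dh ->]]]]].
  rewrite !inE /= => /orP[] /andP[Dg Dh] ->.
    by exists g, h, false.
  by exists g, h, true.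
apply: imset_f; rewrite !inE /=; case: c Dg Dh => -> /= ->; rewrite ?orbT //.
Qed.

Lemma parity_unique n b b' s :
  s \in parity n.+1 b -> s \in parity n.+1 b' -> b = b'.
Proof.
by move=> /imsetP[p _ ->] /imsetP[q _] /wreath_inj[].
Qed.

Lemma parity_one n : 1 \in parity n false.
Proof.
elim: n => [|n IH]; first by rewrite inE.
by apply/mem_parity; exists 1, 1, false; rewrite wreath1.
Qed.

(** When [s] exchanges the halves, the components of [t] are swapped in
    [s * t], so that [(g, h)] and [(g', h')] give [(g * h', h * g')].  As [g]
    and [h] have opposite parities, those of [g * h'] and [h * g'] differ
    exactly when those of [g'] and [h'] agree, that is when [t] is even. *)
Lemma parity_mul n b b' s t :
  s \in parity n b -> t \in parity n b' -> s * t \in parity n (b (+) b').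
Proof.
elim: n b b' s t => [|n IH] b b' s t.
  by rewrite /= !inE => /eqP-> /eqP->; rewrite mulg1.
move=> /mem_parity[g [h [c [Dg Dh ->]]]] /mem_parity[g' [h' [c' [Dg' Dh' ->]]]].
apply/mem_parity; case: b Dh => Dh.
- rewrite wreath_mul1; exists (g * h'), (h * g'), (c (+) (c' (+) b')).
  split=> //; first exact: IH.
  suff <- : (c (+) true) (+) c' = c (+) (c' (+) b') (+) (~~ b') by exact: IH.
  by case: (c) (c') (b') => [] [] [].
- rewrite wreath_mul0; exists (g * g'), (h * h'), (c (+) c').
  split=> //; first exact: IH.
  suff <- : (c (+) false) (+) (c' (+) b') = c (+) c' (+) b' by exact: IH.
  by case: (c) (c') (b') => [] [] [].
Qed.

Definition parities n := parity n false :|: parity n true.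

Lemma mem_parities n s : s \in parities n <-> exists b, s \in parity n b.
Proof.
rewrite inE; split=> [/orP[]|[[] ->]]; rewrite ?orbT //; last by exists true.
by exists false.
Qed.

Lemma parities_group_set n : group_set (parities n).
Proof.
apply/group_setP; split.
  by apply/mem_parities; exists false; exact: parity_one.
move=> s t /mem_parities[b Ds] /mem_parities[c Dt]; apply/mem_parities.
by exists (b (+) c); exact: parity_mul.
Qed.

Canonical parities_group n := Group (parities_group_set n).

Lemma parity_inv n b s : s \in parity n.+1 b -> s^-1 \in parity n.+1 b.
Proof.
move=> Ds; have Gs : s \in parities n.+1 by apply/mem_parities; exists b.
have /mem_parities[c Dc] : s^-1 \in parities n.+1 by rewrite groupV.
suff <- : c = b by [].
have := parity_mul Ds Dc; rewrite mulgV => /(parity_unique (parity_one _)).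
by case: (b) (c) => [] [].
Qed.

(** * Portraits of the generators *)

HB.instance Definition _ (T : finType) :=
  Monoid.isLaw.Build {perm T} 1 (@comp_perm T)
    (fun r s t => esym (mulgA t s r)) (@mulg1 _) (@mul1g _).

Lemma a_wreath n i : 0 < i <= n -> a n.+1 i = wreath false (a n i, 1).
Proof.
move=> i_n; have Hn : 2 ^ i <= 2 ^ n by rewrite leq_exp2l //; case/andP: i_n.
have Hi : 2 ^ i.-1 < 2 ^ i by rewrite ltn_exp2l; lia.
apply: perm_child => c j; apply: val_inj; rewrite aE; last by lia.
rewrite wreathE; case: c => /=; last by rewrite aE.
by rewrite perm1; do !case: ifP; lia.
Qed.

Lemma a_wreath_top n : a n.+1 n.+1 = wreath true (1, 1).
Proof.
apply: perm_child => c j; apply: val_inj; rewrite aE; last by lia.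
rewrite wreathE /= expnS; have := ltn_ord j.
by case: c => /=; rewrite perm1; do !case: ifP; lia.
Qed.

Lemma x_wreath n m : m <= n -> x n.+1 m = wreath false (x n m, 1).
Proof.
move=> m_n; rewrite /x.
rewrite (@big_morph _ _ (fun s => wreath false (s, 1))
  1 (@comp_perm _) 1 (@comp_perm _)).
- by apply: eq_big_nat => i Hi; apply: a_wreath; lia.
- by move=> s t; rewrite /comp_perm wreath_mul0 mulg1.
- exact: wreath1.
Qed.

Lemma x_wreath_top n : x n.+1 n.+1 = wreath true (1, x n n).
Proof.
have -> : x n.+1 n.+1 = comp_perm (x n.+1 n) (a n.+1 n.+1).
  by rewrite /x big_nat_recr.
by rewrite /comp_perm x_wreath // a_wreath_top wreath_mul1 !mul1g.
Qed.

Lemma x_sqr n : x n.+1 n.+1 ^+ 2 = wreath false (x n n, x n n).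
Proof. by rewrite x_wreath_top expgS expg1 wreath_mul1 mul1g mulg1. Qed.

Lemma x_parity n : x n n \in parity n true.
Proof.
elim: n => [|n IH]; first by rewrite /x big_geq // inE.
by apply/mem_parity; exists 1, (x n n), false; rewrite parity_one x_wreath_top.
Qed.

Lemma v_parity n i : i.+2 <= n -> v n i \in parity n false.
Proof.
elim: n => // n IH; rewrite leq_eqVlt => /orP[/eqP[<-]|i_n].
  by rewrite /v expgS expg1 (parity_mul (x_parity _) (x_parity _)).
rewrite /v x_wreath // wreath_exp expg1n; apply/mem_parity.
by exists (v n i), 1, false; rewrite IH // parity_one.
Qed.

(** The two small cases of [M] fit the general pattern, with no [v]. *)
Lemma M_gen n :
  M n.+1 = <<x n.+1 n.+1 |: [set v n.+1 i | i : 'I_n.-1]>>%G.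
Proof.
case: n => [|[|n]] //=; apply/val_inj => /=.
- have -> : x 1 1 = tperm (leaf 1 1) (leaf 1 2) by rewrite /x /a !big_nat1.
  rewrite [X in _ |: X](_ : _ = set0) ?setU0 //.
  by apply/setP=> s; rewrite inE; apply/imsetP=> [] [] [].
- have -> : x 2 2 = cycle_perm uniq_1324.
    apply/permP=> i; apply: val_inj.
    rewrite /x big_ltn // big_nat1 /comp_perm permM !aE //=.
    rewrite permE /= -!val_eqE /leaf !val_insubd /=.
    by case: i => [[|[|[|[|]]]]] //= _; rewrite val_insubd.
  rewrite [X in _ |: X](_ : _ = set0) ?setU0 //.
  by apply/setP=> s; rewrite inE; apply/imsetP=> [] [] [].
Qed.

Lemma M_sub_parities n : M n.+1 \subset parities n.+1.
Proof.
rewrite M_gen gen_subG subUset sub1set; apply/andP; split.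
  by apply/mem_parities; exists true; exact: x_parity.
apply/subsetP=> _ /imsetP[i _ ->]; apply/mem_parities; exists false.
by apply: v_parity; have := ltn_ord i; lia.
Qed.

Lemma x_in_M n : x n.+1 n.+1 \in M n.+1.
Proof. by rewrite M_gen mem_gen // !inE eqxx. Qed.

(** Acting on the left half only, the generators [v n.+1 i] of [M n.+1]
    remain generators of [M n.+2]; the one new generator of the latter besides
    [x] is the square of [x n.+1 n.+1], which is the case [i = n.-1]
    for [0 < n]. *)
Lemma lift_sqr_in_M n i :
  i.+2 <= n.+1 -> wreath false (x n.+1 i.+2 ^+ 2, 1) \in M n.+2.
Proof.
move=> i_n; rewrite M_gen mem_gen //.
apply/setUP; right; apply/imsetP; exists (Ordinal (i_n : i < n.+2.-2)) => //.
by rewrite /v (@x_wreath n.+1) // wreath_exp expg1n.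
Qed.

(** * The groups are the unions of their parity classes *)

Lemma wreath_conj_x n (g h : {perm 'I_(2 ^ n)}) :
  wreath false (g, h) ^ x n.+1 n.+1 = wreath false (h ^ x n n, g).
Proof.
apply: (mulgI (x n.+1 n.+1)).
rewrite -conjgC x_wreath_top wreath_mul0 wreath_mul1.
by rewrite mul1g mulg1 -conjgC.
Qed.

(** The elements [g] for which this holds with their own parity [b] form a
    group, because [(1, x ^+ 2)] belongs to [M n.+2], and they include the
    generators of [M n.+1]: [(x, x)] is the square of the top generator of
    [M n.+2], and [(v, 1)] is a generator. *)
Lemma pair_x_in_M n b g :
  M n.+1 = parities n.+1 :> {set _} ->
  g \in parity n.+1 b -> wreath false (g, x n.+1 n.+1 ^+ b) \in M n.+2.
Proof.
move=> MG Dg; set y := x n.+1 n.+1.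
have My2 : wreath false (1, y ^+ 2) \in M n.+2.
  have -> : wreath false (1, y ^+ 2) = wreath false (y ^+ 2, 1) ^ x n.+2 n.+2.
    by rewrite wreath_conj_x conj1g.
  apply: groupJ (x_in_M _); rewrite /y; case: (n) => [|m].
    by rewrite x_sqr /x big_geq // !wreath1 group1.
  exact: lift_sqr_in_M.
pose Q := [set s | [exists c : bool,
  (s \in parity n.+1 c) && (wreath false (s, y ^+ c) \in M n.+2)]].
have Q_group : group_set Q.
  apply/group_setP; split.
    rewrite inE; apply/existsP; exists false.
    by rewrite parity_one wreath1 group1.
  move=> s t; rewrite !inE.
  move=> /existsP[c /andP[Ds Ms]] /existsP[d /andP[Dt Mt]].
  apply/existsP; exists (c (+) d); rewrite (parity_mul Ds Dt) /=.
  have := groupM Ms Mt; rewrite wreath_mul0 -expgD.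
  (* The two odd factors give [(s * t, x ^+ 2)], to be divided by
     [(1, x ^+ 2)]. *)
  case: (c) (d) => [] [] //.
  by rewrite -{1}[s * t]mulg1 -[y ^+ (_ + _)]mul1g -wreath_mul0 groupMr.
have : g \in Group Q_group.
  have : g \in M n.+1.
    rewrite -[g \in M _]/(g \in (M n.+1 : {set _})) MG.
    by apply/mem_parities; exists b.
  apply: subsetP; rewrite M_gen gen_subG subUset sub1set.
  apply/andP; split; rewrite ?inE.
    apply/existsP; exists true; rewrite x_parity /= -/y expg1.
    by rewrite -x_sqr groupX ?x_in_M.
  apply/subsetP=> _ /imsetP[i _ ->]; rewrite inE; apply/existsP; exists false.
  have i_n : i.+2 <= n.+1 by have := ltn_ord i; lia.
  by rewrite v_parity //=; apply: lift_sqr_in_M.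
by rewrite inE => /existsP[c /andP[/(parity_unique Dg) <-]].
Qed.

(** For [M n.+2] to contain every pair [(g, h)] of equal parities [c], the
    pair is written as [(g, x ^+ c)] times [(1, k)] with [k] even; the latter
    is a conjugate of [(k, 1)] under [x n.+2 n.+2].  An odd element is an even
    one times [x n.+2 n.+2]. *)
Lemma M_eq_parities n : M n.+1 = parities n.+1 :> {set _}.
Proof.
elim: n => [|n IH].
  apply/eqP; rewrite eqEsubset M_sub_parities /=.
  apply/subsetP=> s /mem_parities[b].
  move=> /mem_parity[g [h [c []]]]; rewrite !inE => /eqP-> /eqP-> ->.
  case: b; last by rewrite wreath1 group1.
  have <- : x 1 1 = wreath true (1, 1) by rewrite x_wreath_top /x big_geq.
  exact: x_in_M.
apply/eqP; rewrite eqEsubset M_sub_parities /=.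
apply/subsetP=> s /mem_parities[b].
set y := x n.+1 n.+1.
have even g h c : g \in parity n.+1 c -> h \in parity n.+1 c ->
    wreath false (g, h) \in M n.+2.
  move=> Dg Dh; have Dk : (y ^+ c)^-1 * h \in parity n.+1 false.
    rewrite -(addbb c); apply: parity_mul => //; apply: parity_inv.
    by case: (c); [exact: x_parity | exact: parity_one].
  rewrite -[g]mulg1 -[h](mulKVg (y ^+ c)) -wreath_mul0 groupM ?pair_x_in_M //.
  rewrite -[1](conj1g y) -wreath_conj_x groupJ ?x_in_M //.
  exact: (@pair_x_in_M _ false).
move=> /mem_parity[g [h [c [Dg Dh ->]]]]; case: b Dh => Dh; last first.
  by apply: (even _ _ c) => //; rewrite -[c]addbF.
rewrite -[g]mulg1 -[h](mulgKV y) -wreath_mul0 -x_wreath_top.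
rewrite groupM ?x_in_M //; apply: (even _ _ c) => //.
rewrite -[c](addbK true); apply: parity_mul => //.
by apply: parity_inv; exact: x_parity.
Qed.

Local Open Scope nat_scope.

(** * Cycle types *)

Definition orbit_sizes (T : finType) (P : {set {set T}}) : seq nat :=
  [seq #|C| | C : {set T} in P].

Lemma cycle_typeE (T : finType) (s : {perm T}) :
  perm_eq (cycle_type s) (orbit_sizes (porbits s)).
Proof. by rewrite /cycle_type perm_sort. Qed.

Lemma orbit_sizesU (T : finType) (P Q : {set {set T}}) :
  [disjoint P & Q] ->
  perm_eq (orbit_sizes (P :|: Q)) (orbit_sizes P ++ orbit_sizes Q).
Proof.
move=> dPQ; rewrite /orbit_sizes /image_mem -map_cat; apply: perm_map.
apply: uniq_perm; rewrite ?enum_uniq ?cat_uniq //.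
- rewrite !enum_uniq andbT /=; apply/hasPn=> C; rewrite !mem_enum => QC.
  by rewrite (disjointFl dPQ).
- by move=> C; rewrite mem_cat !mem_enum inE.
Qed.

Lemma orbit_sizes_imset (T U : finType) (f : T -> U) (P : {set {set T}}) :
  injective f ->
  perm_eq (orbit_sizes [set f @: (C : {set T}) | C in P]) (orbit_sizes P).
Proof.
move=> f_inj; have F_inj := imset_inj f_inj.
rewrite /orbit_sizes /image_mem.
have -> : [seq #|pred_of_set C| | C <- enum P]
    = [seq #|pred_of_set C| | C <- [seq f @: (C : {set T}) | C <- enum P]].
  by rewrite -map_comp; apply: eq_map => C /=; rewrite card_imset.
apply/perm_map/uniq_perm; rewrite ?enum_uniq ?map_inj_uniq ?enum_uniq //.
move=> C; rewrite mem_enum; apply/imsetP/mapP=> [] [B PB ->].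
  by exists B; rewrite ?mem_enum.
by exists B; rewrite // -mem_enum.
Qed.

Lemma porbit_wreath n (g h : {perm 'I_(2 ^ n)}) c i :
  porbit (wreath false (g, h)) (child c i)
  = child c @: porbit (if c then h else g) i.
Proof.
apply/setP=> k; apply/porbitP/imsetP=> [[m ->]|[j /porbitP[m ->] ->]].
- exists (((if c then h else g) ^+ m)%g i); first by apply/porbitP; exists m.
  by rewrite wreath_exp wreathE addbF; case: (c).
- by exists m; rewrite wreath_exp wreathE addbF; case: (c).
Qed.

Lemma cycle_type_wreath n (g h : {perm 'I_(2 ^ n)}) :
  perm_eq (cycle_type (wreath false (g, h))) (cycle_type g ++ cycle_type h).
Proof.
pose up c (s : {perm 'I_(2 ^ n)}) :=
  [set child c @: (C : {set _}) | C in porbits s].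
have E : porbits (wreath false (g, h)) = up false g :|: up true h.
  apply/setP=> C; rewrite inE; apply/imsetP/orP.
  - move=> [k _ ->]; rewrite -[k]child_side_pos porbit_wreath.
    by case: (side k); [right | left]; apply: imset_f; apply: imset_f.
  - by move=> [] /imsetP[_ /imsetP[i _ ->] ->];
      [exists (child false i) | exists (child true i)];
      rewrite ?porbit_wreath.
have dis : [disjoint up false g & up true h].
  rewrite -setI_eq0; apply/eqP/setP=> C; rewrite !inE; apply/negP=> /andP[].
  move=> /imsetP[_ /imsetP[i _ ->] ->] /imsetP[B _ EC].
  have := imset_f (child false) (porbit_id g i).
  rewrite EC => /imsetP[j _ /(congr1 (@side n))].
  by rewrite !side_child.
apply: perm_trans (cycle_typeE _) _; rewrite E.
apply: perm_trans (orbit_sizesU dis) _.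
have red c s : perm_eq (orbit_sizes (up c s)) (cycle_type s).
  apply: perm_trans (orbit_sizes_imset _ (@child_inj n c)) _.
  by rewrite perm_sym; apply: cycle_typeE.
exact: perm_cat.
Qed.

Definition full_cycle (T : finType) (s : {perm T}) :=
  forall i j, j \in porbit s i.

Lemma cycle_type_full (T : finType) (s : {perm T}) (i : T) :
  full_cycle s -> cycle_type s = [:: #|T|].
Proof.
move=> full; have orb j : porbit s j = setT.
  by apply/setP=> k; rewrite inE full.
have E : porbits s = [set setT].
  apply/setP=> C; rewrite inE.
  apply/imsetP/eqP=> [[j _ ->]|->]; first exact: orb.
  by exists i; rewrite ?orb.
apply: perm_small_eq => //; apply: perm_trans (cycle_typeE _) _.
by rewrite E /orbit_sizes /image_mem enum_set1 /= cardsT.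
Qed.

(** The square of [wreath true (g, h)] acts as [g * h] on the left half, so
    one orbit covers that half; and every leaf of the right half is the image
    of a leaf of the left half. *)
Lemma full_cycle_wreath n (g h : {perm 'I_(2 ^ n)}) :
  full_cycle (g * h)%g -> full_cycle (wreath true (g, h)).
Proof.
move=> full.
pose s := wreath true (g, h).
have s2 : (s ^+ 2)%g = wreath false (g * h, h * g)%g.
  by rewrite expgS expg1 wreath_mul1.
have low i j : child false j \in porbit s (child false i).
  have /porbitP[m ->] := full i j; apply/porbitP; exists (2 * m).
  by rewrite expgM s2 wreath_exp wreathE.
have conn k : porbit s k = porbit s (child false (pos k)).
  apply/eqP; rewrite eq_porbit_mem; rewrite -{1}[k]child_side_pos.
  case: (side k); last exact: low.
  have -> : child true (pos k) = s (child false ((g^-1)%g (pos k))).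
    by rewrite wreathE permKV.
  rewrite -(expg1 s) -eq_porbit_mem porbit_perm eq_porbit_mem; exact: low.
move=> k l; rewrite -eq_porbit_mem (conn k) (conn l) eq_porbit_mem; exact: low.
Qed.

Lemma odd_full_cycle n s : s \in parity n true -> full_cycle s.
Proof.
elim: n s => [|n IH] s.
  move=> _ [[|] //= p] [[|] //= q].
  by rewrite (_ : Ordinal q = Ordinal p) ?porbit_id //; apply: val_inj.
move=> /mem_parity[g [h [c [Dg Dh ->]]]]; apply/full_cycle_wreath/IH.
by have := parity_mul Dg Dh; rewrite addbA addbb.
Qed.

Lemma cycle_type_odd n s : s \in parity n true -> cycle_type s = [:: 2 ^ n].
Proof.
move=> /odd_full_cycle/(cycle_type_full (leaf n 1)); by rewrite card_ord.
Qed.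

Local Open Scope ring_scope.

(** * The model as a branching process *)

(** The integral of [phi] against the weighted collection [D]. *)
Definition expect (D : model_data) (phi : seq factor -> rat) : rat :=
  \sum_(p <- D) p.2 * phi p.1.

Definition evolve m (fs : seq factor) : model_data :=
  iter m next_level [:: (fs, 1)].

Definition sizes (fs : seq factor) : seq nat := [seq f.2 | f <- fs].

Lemma eq_expect D phi psi : phi =1 psi -> expect D phi = expect D psi.
Proof. by move=> E; apply: eq_bigr => p _; rewrite E. Qed.

Lemma expect1 fs phi : expect [:: (fs, 1)] phi = phi fs.
Proof. by rewrite /expect big_seq1 mul1r. Qed.

Lemma exchange_expect (C D : model_data)
    (phi : seq factor -> seq factor -> rat) :
  expect C (fun fs => expect D (phi fs)) =
  expect D (fun gs => expect C (phi^~ gs)).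
Proof.
rewrite /expect; under eq_bigr do rewrite mulr_sumr.
rewrite exchange_big /=; apply: eq_bigr => q _; rewrite mulr_sumr.
by apply: eq_bigr => p _; rewrite mulrCA.
Qed.

Lemma expect_next D phi :
  expect (next_level D) phi =
  expect D (fun fs => expect (replace_product fs) phi).
Proof.
rewrite /expect big_allpairs_dep; apply: eq_bigr => p _.
by rewrite mulr_sumr; apply: eq_bigr => q _; rewrite /= mulrA.
Qed.

Lemma expect_iter m D phi :
  expect (iter m next_level D) phi =
  expect D (fun fs => expect (evolve m fs) phi).
Proof.
elim: m phi => [|m IH] phi; first by apply: eq_expect => fs; rewrite expect1.
rewrite iterS expect_next IH; apply: eq_expect => fs.
by rewrite /evolve iterS expect_next.
Qed.

Lemma expect_replace_cons f fs phi :
  expect (replace_product (f :: fs)) phi =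
  expect (replace_factor f)
    (fun p => expect (replace_product fs) (fun q => phi (p ++ q))).
Proof.
rewrite /expect big_allpairs_dep; apply: eq_bigr => p _.
by rewrite mulr_sumr; apply: eq_bigr => q _; rewrite /= mulrA.
Qed.

Lemma expect_replace_cat fs gs phi :
  expect (replace_product (fs ++ gs)) phi =
  expect (replace_product fs)
    (fun p => expect (replace_product gs) (fun q => phi (p ++ q))).
Proof.
elim: fs phi => [|f fs IH] phi; first by rewrite expect1.
rewrite cat_cons !expect_replace_cons; apply: eq_expect => p.
rewrite IH; apply: eq_expect => q; apply: eq_expect => r.
by rewrite catA.
Qed.

Lemma expect_evolveS m fs phi :
  expect (evolve m.+1 fs) phi =
  expect (replace_product fs) (fun gs => expect (evolve m gs) phi).
Proof. by rewrite /evolve iterSr expect_iter expect_next expect1. Qed.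

(** Factors evolve independently.  The induction step interchanges one step of
    the second block with the remaining steps of the first one. *)
Lemma expect_evolve_cat m fs gs phi :
  expect (evolve m (fs ++ gs)) phi =
  expect (evolve m fs)
    (fun p => expect (evolve m gs) (fun q => phi (p ++ q))).
Proof.
elim: m fs gs phi => [|m IH] fs gs phi; first by rewrite !expect1.
rewrite !expect_evolveS expect_replace_cat; apply: eq_expect => p.
under eq_expect do rewrite IH.
rewrite exchange_expect; apply: eq_expect => q.
by rewrite expect_evolveS.
Qed.

Lemma expect_replace1 f phi :
  expect (replace_product [:: f]) phi = expect (replace_factor f) phi.
Proof.
rewrite expect_replace_cons; apply: eq_expect => p.
by rewrite expect1 cats0.
Qed.

Lemma expect_evolve_n m d phi :
  expect (evolve m [:: (type_n, d)]) phi = phi [:: (type_n, 2 ^ m * d)%N].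
Proof.
elim: m d => [|m IH] d; first by rewrite expect1 mul1n.
by rewrite expect_evolveS expect_replace1 expect1 IH mulnA -expnSr.
Qed.

Lemma expect_evolve_nn m d phi :
  expect (evolve m [:: (type_n, d); (type_n, d)]) phi
  = phi [:: (type_n, 2 ^ m * d)%N; (type_n, 2 ^ m * d)%N].
Proof.
rewrite (expect_evolve_cat m [:: (type_n, d)] [:: (type_n, d)]).
by rewrite !expect_evolve_n.
Qed.

Lemma expect_evolve_s m d phi :
  expect (evolve m.+1 [:: (type_s, d)]) phi =
  1 / 2 * phi [:: (type_n, 2 ^ m * d)%N; (type_n, 2 ^ m * d)%N] +
  1 / 2 * expect (evolve m [:: (type_s, d)])
    (fun p => expect (evolve m [:: (type_s, d)]) (fun q => phi (p ++ q))).
Proof.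
rewrite expect_evolveS expect_replace1 /expect big_cons big_seq1 /=.
rewrite -!/(expect _ _) expect_evolve_nn.
by rewrite (expect_evolve_cat m [:: (type_s, d)] [:: (type_s, d)]).
Qed.

(** The last two terms of the first level are the two equally likely successors
    of [[s,1]], with the weight 1/4 instead of 1/2. *)
Lemma expect_level n phi :
  expect (level n.+1) phi =
  1 / 2 * phi [:: (type_n, 2 ^ n.+1)%N] +
  1 / 2 * expect (evolve n.+1 [:: (type_s, 1%N)]) phi.
Proof.
rewrite /level expect_iter /expect /level1 !big_cons big_nil addr0 /=.
rewrite -!/(expect _ _).
rewrite expect_evolve_n expect_evolve_nn expect_evolve_s.
rewrite (expect_evolve_cat n [:: (type_s, _)] [:: (type_s, _)]) -expnSr muln1.
by field.
Qed.

(** * Comparison of the group with the model *)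

Lemma sum_parity n b (F : {perm 'I_(2 ^ n.+2)} -> rat) :
  \sum_(s in parity n.+2 b) F s =
  \sum_(g in parity n.+1 false) \sum_(h in parity n.+1 b) F (wreath b (g, h)) +
  \sum_(g in parity n.+1 true) \sum_(h in parity n.+1 (~~ b))
    F (wreath b (g, h)).
Proof.
rewrite big_imset => [|p q _ _ /wreath_inj[]//].
have pairE (A B : {set {perm 'I_(2 ^ n.+1)}}) :
    \sum_(g in A) \sum_(h in B) F (wreath b (g, h))
    = \sum_(p | (p.1 \in A) && (p.2 \in B)) F (wreath b p).
  by rewrite pair_big; apply: eq_bigr => [[]].
have dis : [disjoint
    [pred p | (p.1 \in parity n.+1 false) && (p.2 \in parity n.+1 b)]
    & [pred p | (p.1 \in parity n.+1 true) && (p.2 \in parity n.+1 (~~ b))]].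
  apply/pred0P=> [[g h]]; apply/negP => /= /andP[/andP[g0 _] /andP[g1 _]].
  by have := parity_unique g0 g1.
rewrite !pairE -(bigU _ _ _ dis); apply: eq_bigl => p.
by rewrite !inE.
Qed.

Lemma card_odd_even n : #|parity n.+1 true| = #|parity n.+1 false|.
Proof.
rewrite -(card_imset (parity n.+1 false) (mulIg (x n.+1 n.+1))).
apply: eq_card => s; apply/idP/imsetP=> [Ds | [t Dt ->]]; last first.
  exact: (parity_mul Dt (x_parity _)).
exists (s * (x n.+1 n.+1)^-1)%g; last by rewrite mulgKV.
exact: (parity_mul Ds (parity_inv (x_parity _))).
Qed.

Lemma cycle_type_wreath1 :
  perm_eq (cycle_type (wreath false (1, 1) : {perm 'I_(2 ^ 1)})%g) [:: 1; 1]%N.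
Proof.
have c1 : cycle_type (1%g : {perm 'I_(2 ^ 0)}) = [:: 1%N].
  by rewrite cycle_type_odd // inE.
by apply: perm_trans (cycle_type_wreath _ _) _; rewrite c1.
Qed.

(** Both sides satisfy the same recursion: the pairs of odd elements match the
    transition of [[s,1]] to [[n,1][n,1]], the pairs of even elements match its
    transition to [[s,1][s,1]].  The sum over the latter pairs is computed one
    component at a time, each time applying the induction hypothesis to another
    test function. *)
Lemma sum_even n (phi : seq nat -> rat) :
  (forall l m, perm_eq l m -> phi l = phi m) ->
  \sum_(s in parity n.+1 false) phi (cycle_type s) =
  #|parity n.+1 false|%:R
    * expect (evolve n.+1 [:: (type_s, 1%N)]) (fun fs => phi (sizes fs)).
Proof.
elim: n phi => [|n IH] phi phi_perm.
  have -> : parity 1 false = [set wreath false (1, 1)]%g.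
    apply/setP=> s; rewrite inE; apply/idP/eqP=> [/mem_parity[g [h [c []]]]|->].
      by rewrite !inE => /eqP-> /eqP->.
    by rewrite wreath1 parity_one.
  rewrite big_set1 cards1 mul1r (phi_perm _ _ cycle_type_wreath1).
  by rewrite expect_evolve_s !expect1 /sizes /= !mul1n; field.
set E := expect (evolve n.+1 [:: (type_s, 1%N)]).
set N := #|parity n.+1 false|%:R : rat.
have const_sum (c : rat) :
    \sum_(g in parity n.+1 true) \sum_(h in parity n.+1 true) c = N * N * c.
  by rewrite !sumr_const card_odd_even -mulrnA -(mulr_natl c) natrM.
have card2 : #|parity n.+2 false|%:R = 2 * (N * N) :> rat.
  rewrite -sumr_const (sum_parity false (fun=> 1)) const_sum.
  by rewrite !sumr_const -mulrnA natrM -/N; ring.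
rewrite sum_parity card2 expect_evolve_s -/E.
have -> : \sum_(g in parity n.+1 true) \sum_(h in parity n.+1 (~~ false))
    phi (cycle_type (wreath false (g, h)))
  = N * N * phi [:: 2 ^ n.+1; 2 ^ n.+1]%N.
  rewrite -const_sum; apply: eq_bigr => g Dg; apply: eq_bigr => h Dh.
  by rewrite (phi_perm _ _ (cycle_type_wreath _ _)) !cycle_type_odd.
pose mean l := E (fun q => phi (l ++ sizes q)).
have -> : \sum_(g in parity n.+1 false) \sum_(h in parity n.+1 false)
    phi (cycle_type (wreath false (g, h)))
  = N * (N * E (fun p => mean (sizes p))).
  transitivity (\sum_(g in parity n.+1 false) N * mean (cycle_type g)).
    apply: eq_bigr => g _.
    rewrite (eq_bigr (fun h => phi (cycle_type g ++ cycle_type h))); last first.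
      by move=> h _; apply/phi_perm/cycle_type_wreath.
    apply: (IH (fun l => phi (cycle_type g ++ l))) => l m lm.
    by apply: phi_perm; rewrite perm_cat2l.
  rewrite -mulr_sumr IH // => l m lm.
  by apply: eq_expect => q; apply: phi_perm; rewrite perm_cat2r.
have -> : E (fun p => E (fun q => phi (sizes (p ++ q))))
  = E (fun p => mean (sizes p)).
  by apply: eq_expect => p; apply: eq_expect => q; rewrite /sizes map_cat.
by rewrite /sizes /= muln1; field.
Qed.

Lemma cycle_type_eq (T : finType) (s : {perm T}) lam :
  sorted geq lam -> (cycle_type s == lam) = perm_eq (cycle_type s) lam.
Proof.
move=> lam_sorted; apply/eqP/idP=> [-> //|].
apply: (sorted_eq (leT := geq)) => //.
- by move=> i j k /= ij jk; apply: leq_trans jk ij.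
- by move=> i j /andP[/= ij ji]; apply/eqP; rewrite eqn_leq ji ij.
- by apply: sort_sorted => i j; apply: leq_total.
Qed.

Theorem theoremA (n : nat) (n_ge1 : (1 <= n)%N) : satisfies_model1 (M n).
Proof.
case: n n_ge1 => // n _ lam /and3P[lam_sorted _ _].
pose phi l : rat := (perm_eq l lam)%:R.
have phi_perm l m : perm_eq l m -> phi l = phi m.
  by move=> /permPl lm; rewrite /phi lm.
have dis : [disjoint parity n.+1 false & parity n.+1 true].
  by apply/pred0P=> s; apply/negP=> /andP[s0 s1]; have := parity_unique s0 s1.
set N := #|parity n.+1 false|%:R : rat.
have N_neq0 : N != 0.
  by rewrite pnatr_eq0 -lt0n; apply/card_gt0P; exists 1%g; apply: parity_one.
have -> : #|M n.+1|%:R = 2 * N.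
  rewrite -[#|M _|]/(#|(M _ : {set _})|) M_eq_parities cardsU.
  move: dis; rewrite -setI_eq0 => /eqP->; rewrite cards0 subn0 card_odd_even.
  by rewrite natrD /N; ring.
have -> : #|[set s in M n.+1 | cycle_type s == lam]|%:R
    = \sum_(s in M n.+1) phi (cycle_type s).
  rewrite -sum1_card natr_sum big_mkcond [RHS]big_mkcond /=.
  apply: eq_bigr => s _; rewrite inE cycle_type_eq // /phi.
  by case: (s \in M _); case: perm_eq.
have -> : cycle_data n.+1 lam = expect (level n.+1) (fun fs => phi (sizes fs)).
  rewrite /cycle_data big_mkcond; apply: eq_bigr => p _.
  by rewrite /phi; case: ifP; rewrite ?mulr1 ?mulr0.
have -> : \sum_(s in M n.+1) phi (cycle_type s)
    = \sum_(s in parity n.+1 false) phi (cycle_type s)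
      + N * phi [:: 2 ^ n.+1]%N.
  rewrite (eq_bigl (mem (parities n.+1))); last first.
    by move=> s; rewrite -M_eq_parities.
  have -> : N * phi [:: 2 ^ n.+1]%N
      = \sum_(s in parity n.+1 true) phi (cycle_type s).
    under eq_bigr => s Ds do rewrite (cycle_type_odd Ds).
    by rewrite sumr_const card_odd_even mulr_natl.
  by rewrite -(bigU _ _ _ dis); apply: eq_bigl => s; rewrite !inE.
rewrite sum_even // expect_level -/N /sizes /=.
by field.
Qed.
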